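(* Let $q$ be a prime power and let $k$ and $T$ be integers such that $0\le T<k$. Let $G$ be a finite abelian group such that $\gcd(q,|G|)=1$ and let $g\in G$ be such that $\operatorname{ord}(g)=d$. Then $S_{q^k}(g)$ is of type $T$ if and only if $d\in G_{(T,k)}(q,1)$. In particular, the type of $S_{q^k}(g)$ depends only on the order of $g$.
   Context: The group $G$ is written additively and $\operatorname{ord}(g)$ is the order of $g$ in $G$. The $q^k$-cyclotomic class containing $g\in G$ is $S_{q^k}(g)=\{q^{kj}g: j\ge 0\}$. For $0\le T<k$, the class $S_{q^k}(g)$ is said to be of type $T$ if $S_{q^k}(g)=S_{q^k}(-q^Tg)$ (and of type $T'$ otherwise). $G_{(T,k)}(q,1)$ denotes the set of positive integers $d$ such that $d\mid (q^{ks+T}+1)$ for some positive integer $s$. *)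

(* Defs.v *)
From mathcomp Require Import all_boot all_fingroup all_algebra.
From mathcomp Require Import boolp classical_sets.
Set Implicit Arguments.
Unset Strict Implicit.
Unset Printing Implicit Defensive.

(* Finite abelian groups are written additively, as finZmodType; the order of
   g : G is then #[g]%g, for the finGroupType structure that MathComp puts on
   the additive group G. *)

Definition prime_power (q : nat) : Prop :=
  exists p m : nat, [/\ prime p, 0 < m & q = p ^ m].

Definition cyclotomic_class (q k : nat) (G : finZmodType) (g : G) : set G :=
  [set (g *+ (q ^ (k * j)))%R | j in [set: nat]]%classic.

Definition of_type (q k T : nat) (G : finZmodType) (g : G) : Prop :=
  cyclotomic_class q k g = cyclotomic_class q k (- (g *+ (q ^ T)))%R.

(* Usually written G_(T,k)(q,1); s = 0 is excluded. *)
Definition good_integers (q k T : nat) : set nat :=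
  [set d | 0 < d /\ exists s : nat, 0 < s /\ d %| q ^ (k * s + T) + 1]%classic.

(* Main.v *)
Require Import Defs.
From mathcomp Require Import all_boot all_fingroup all_algebra.
From mathcomp Require Import boolp classical_sets.
From mathcomp Require Import cyclic.

Import GRing.Theory.

(** Multiplication by [q] is a permutation of [G], because [q] is prime to
    [#|G|], and by Euler's theorem its power of exponent [totient #|G|] is the
    identity ([mulrn_exp_totient]).  So the forward orbits of multiplication by
    [q ^ k] are full orbits, and two of them coincide as soon as one contains
    the starting point of the other ([cyclotomic_class_eqP]).  Hence [g] is of
    type [T] exactly when [g] lies in the class of [- q ^ T g], that is, when
    [(q ^ (k s + T) + 1) g = 0] for some [s], and this says that [#[g]] divides
    [q ^ (k s + T) + 1].  The exponent [s] may always be taken positive, since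
    adding [totient #|G|] to it changes nothing.  As the resulting criterion
    mentions [g] only through its order, it compares elements of different
    groups as well. *)

Local Open Scope ring_scope.

Lemma dvdn_order_mulrn (G : finZmodType) (g : G) (n : nat) :
  (#[g]%g %| n)%N = (g *+ n == 0).
Proof. by rewrite order_dvdn FinRing.zmodXgE. Qed.

Lemma mulrn_exp_totient (q : nat) (G : finZmodType) (x : G) (m : nat) :
  coprime q #|G| -> x *+ q ^ (totient #|G| * m) = x.
Proof.
move=> hG; elim: m => [|m IHm]; first by rewrite muln0 expn0 mulr1n.
rewrite mulnS expnD mulrnA.
suff -> : x *+ q ^ totient #|G| = x by [].
have xG0 : x *+ #|G| = 0.
  by apply/eqP; rewrite -dvdn_order_mulrn -cardsT order_dvdG ?inE.
have mod_card n : x *+ (n %% #|G|) = x *+ n.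
  by rewrite [in RHS](divn_eq n #|G|) mulrnDr mulnC mulrnA xG0 mul0rn add0r.
by rewrite -mod_card Euler_exp_totient // mod_card.
Qed.

(** Walking on from a point of an orbit stays inside it; the starting point is
    reached again because the orbit is periodic. *)
Lemma cyclotomic_class_eqP (q k : nat) (G : finZmodType) (x y : G) :
  coprime q #|G| ->
  cyclotomic_class q k x = cyclotomic_class q k y <->
  exists s : nat, y *+ q ^ (k * s) = x.
Proof.
have sub (u v : G) (s : nat) : v *+ q ^ (k * s) = u ->
    (cyclotomic_class q k u `<=` cyclotomic_class q k v)%classic.
  by move=> <- _ [j _ <-]; exists (s + j)%N; rewrite // mulnDr expnD mulrnA.
move=> hG; split=> [Sxy | [s ysx]].
  have : cyclotomic_class q k x x by exists 0%N; rewrite // muln0 expn0 mulr1n.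
  by rewrite Sxy => -[s _ ysx]; exists s.
rewrite eqEsubset; split; first exact: sub ysx.
(* [totient #|G| * s] steps from [y] lead back to [y]; the first [s] of them
   lead to [x]. *)
have N_gt0 : (0 < totient #|G|)%N.
  by rewrite totient_gt0 -cardsT cardG_gt0.
apply: (sub _ _ ((totient #|G|).-1 * s)%N).
rewrite -ysx -mulrnA -expnD -mulnDr -mulSn prednK // mulnCA.
exact: mulrn_exp_totient.
Qed.

Lemma of_type_order (q k T : nat) (G : finZmodType) (g : G) :
  coprime q #|G| -> of_type q k T g <-> good_integers q k T #[g]%g.
Proof.
move=> hG.
have dvdE s : (#[g]%g %| q ^ (k * s + T) + 1)%N <->
    - (g *+ q ^ T) *+ q ^ (k * s) = g.
  rewrite dvdn_order_mulrn mulrnDr mulr1n addnC expnD mulrnA mulNrn addr_eq0.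
  by rewrite -eqr_oppLR; split=> /eqP.
rewrite /of_type cyclotomic_class_eqP //; split=> [[s gs] | [_ [s [_ /dvdE gs]]]];
  last by exists s.
split; first exact: order_gt0.
exists (s + totient #|G|)%N; split.
  by rewrite addn_gt0 totient_gt0 -cardsT cardG_gt0 orbT.
apply/dvdE.
by rewrite mulnDr expnD mulrnA gs mulnC mulrn_exp_totient.
Qed.

Local Close Scope ring_scope.

Theorem theorem23 (q k T : nat) (hq : prime_power q) (hT : T < k)
    (G : finZmodType) (hG : coprime q #|G|) :
  (forall (g : G) (d : nat), #[g]%g = d ->
     (of_type q k T g <-> good_integers q k T d)) /\
  (forall (H : finZmodType), coprime q #|H| ->
     forall (g : G) (h : H), #[g]%g = #[h]%g ->
     (of_type q k T g <-> of_type q k T h)).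
Proof.
split=> [g d <- | H hH g h gh]; first exact: of_type_order.
by rewrite !of_type_order // gh.
Qed.
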